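(* Let $r>1$ and let $\mu$ be a non-atomic Borel probability measure on $\mathbb{R}$ with $\int |x|^r\,d\mu(x)<\infty$. For any $n\in\mathbb{N}$ the set $\mathcal{G}(n,\mu,r)$ of $n$-level Gersho quantizers of order $r$ for $\mu$ is not empty. Moreover, if the support of $\mu$ is a (possibly unbounded) interval, then exactly one $n$-level Gersho quantizer exists, i.e. $\operatorname{card}(\mathcal{G}(n,\mu,r))=1$.
   Context: A quantizer is a Borel-measurable map $q:\mathbb{R}\to\mathbb{R}$ with countable (finite or countably infinite) image. Its distortion is $D(\mu,q,r)=\int |x-q(x)|^r\,d\mu(x)$. The set $q^{-1}(a)$ is the codecell of $a\in q(\mathbb{R})$. For Borel $A$ with $\mu(A)>0$, $\mu(\cdot|A)$ is the conditional probability. A quantizer $q$ is an $n$-level Gersho quantizer of order $r$ for $\mu$ if (G1) $\operatorname{card}(q(\mathbb{R}))=n$; (G2) $q^{-1}(a)$ is an interval for every $a\in q(\mathbb{R})$; (G3) every $a\in q(\mathbb{R})$ is optimal for its own codecell, i.e. $\int |x-a|^r\,d\mu(x|q^{-1}(a))=\inf_{b\in\mathbb{R}}\int |x-b|^r\,d\mu(x|q^{-1}(a))$; (G4) $\int_{q^{-1}(a)}|x-a|^r\,d\mu(x)=\frac1n D(\mu,q,r)$ for every $a\in q(\mathbb{R})$. (Since $\mu$ is non-atomic, $D(\mu,q,r)>0$, so (G4) implies that all codecells have positive $\mu$-mass and (G3) makes sense.) The set of all such quantizers is $\mathcal{G}(n,\mu,r)$. Convention: since $\mu$ is non-atomic,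 the codecells $I_1,\dots,I_n$ of a Gersho quantizer, listed in increasing order, are always taken in the normalized form $I_1=(a_1,b_1)$ and $I_i=[a_i,b_i)$ for $i\in\{2,\dots,n\}$, where $a_1=-\infty$, $b_n=\infty$ and $a_i=b_{i-1}$ for $i\in\{2,\dots,n\}$. *)

(* Defs.v *)
From HB Require Import structures.
From mathcomp Require Import all_boot all_order all_algebra.
From mathcomp Require Import all_classical all_reals all_analysis.

Set Implicit Arguments.
Unset Strict Implicit.
Unset Printing Implicit Defensive.

Import Order.TTheory GRing.Theory Num.Theory.
Import numFieldNormedType.Exports.

Local Open Scope classical_set_scope.
Local Open Scope ring_scope.
Local Open Scope ereal_scope.

Section MeasuresOnTheLine.
Context {R : realType}.
Implicit Types (mu : set (measurableTypeR R) -> \bar R).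

Definition is_atom mu (A : set (measurableTypeR R)) : Prop :=
  [/\ measurable A, 0 < mu A &
      forall B : set (measurableTypeR R), measurable B -> B `<=` A ->
        mu B = 0 \/ mu B = mu A].

Definition non_atomic mu : Prop := forall A, ~ is_atom mu A.

Definition measure_support mu : set R :=
  [set x | forall U : set R, open U -> U x -> 0 < mu U].

(* mu( . | A); this is the zero set function when mu A = 0. *)
Definition cond_prob mu (A : set (measurableTypeR R)) :
    set (measurableTypeR R) -> \bar R :=
  fun B => mu (B `&` A) * ((fine (mu A))^-1)%:E.

End MeasuresOnTheLine.

Section Gersho.
Context {R : realType}.
Implicit Types (mu : set (measurableTypeR R) -> \bar R) (q : R -> R) (n : nat).

Definition quantizer q : Prop :=
  measurable_fun setT (q : measurableTypeR R -> measurableTypeR R) /\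
  countable (range q).

Definition distortion mu q (r : R) : \bar R :=
  \int[mu]_x (`|x - q x| `^ r)%:E.

Definition codecell q (a : R) : set R := q @^-1` [set a].

(* The codecells are (b_0, b_1), [b_1, b_2), ..., [b_(n-1), b_n), where
   b_0 = -oo and b_n = +oo; since x ranges over reals, the bound -oo <= x
   leaves the first cell open. *)
Definition normalized_codecells q n : Prop :=
  exists b : nat -> \bar R,
    [/\ b 0%N = -oo, b n = +oo,
        forall i, (i < n)%N -> b i < b i.+1 &
        codecell q @` range q =
          [set [set x : R | b i <= x%:E < b i.+1] | i in `I_n]].

(* When mu A = 0 for the codecell A of a, the optimality condition is void for
   a; the equipartition condition excludes such codecells for the non-atomic
   measures considered here, as the distortion is then positive. *)
Definition gersho_quantizers n mu (r : R) : set (R -> R) :=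
  [set q | quantizer q /\
    [/\ (range q #= `I_n)%card,
        forall a, range q a -> is_interval (codecell q a),
        forall a, range q a ->
          \int[cond_prob mu (codecell q a)]_x (`|x - a| `^ r)%:E =
          ereal_inf (range (fun b : R =>
            \int[cond_prob mu (codecell q a)]_x (`|x - b| `^ r)%:E)),
        forall a, range q a ->
          \int[mu]_(x in codecell q a) (`|x - a| `^ r)%:E =
          (n%:R^-1)%:E * distortion mu q r &
        normalized_codecells q n]].

End Gersho.

(* Main.v *)
Require Import Defs.
From HB Require Import structures.
From mathcomp Require Import all_boot all_order all_algebra.
From mathcomp Require Import all_classical all_reals all_analysis.
From mathcomp Require Import measurable_realfun ring lra.
Import Order.TTheory GRing.Theory Num.Theory.
Import numFieldNormedType.Exports.

Set Implicit Arguments.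
Unset Strict Implicit.
Unset Printing Implicit Defensive.

(** Write V(A) for the infimum over b of the integral of |x - b|^r over A,
    the best cost of serving A from a single level. A Gersho quantizer is
    a partition of the line into n cells with equal V, each cell being
    served by an optimal level of its own.

    Existence. As mu has no atoms, its distribution function F is
    continuous. The cells {x | u <= F x < w}, for u <= w, have measure at
    most w - u, and they are intervals, closed at a finite left end and
    open at a finite right end, so that the cut points of a partition can
    be looked for among the values of F, from 0 up to 2 (which F never
    reaches). The cost V is monotone for inclusion, and uniformly
    continuous for the measure of the difference of nested sets: V(B) <=
    V(A) + e as soon as A is included in B and mu(B \ A) is small, however
    small A itself may be ([best_cost_modulus]). Hence the cost of cells
    is continuous in the end points, and [equal_split] builds by induction
    on n a nondecreasing continuous function W_n such that [0, w) is cut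
    into n cells of cost exactly W_n(w): the last cut s solves W_n(s) =
    V(s, w), by the intermediate value theorem. The common cost is
    positive, since some cell has positive measure; hence all cells have
    positive measure. Optimal levels exist by compactness. They are
    pairwise distinct because an optimal level for a set on the left of t
    lies strictly on the left of t ([minimizer_lt]), while one for a set
    on the right of t is at least t ([minimizer_ge]).

    Uniqueness. Let two partitions have the costs v <= v'. If the support
    of mu is an interval, then every cut of the first is at most the
    corresponding cut of the second: at a first violation, the cell of the
    second partition would be included in that of the first, and smaller
    by a set of positive measure, whence v' < v ([gersho_cells_le]). In
    particular the last cell of the second is included in that of the
    first, so v' <= v ([gersho_cells_cost_le]). So the costs agree, then
    the cuts, and finally the levels, because the cost is strictly convex
    in the level when r > 1 ([cost_minimizer_unique]). *)

Local Open Scope classical_set_scope.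
Local Open Scope ring_scope.

(** Subsets of the line, at the type that carries its Borel sigma-algebra. *)
Local Notation mset R := (set (measurableTypeR R)).

(** * Inequalities for real powers *)

(** With y = exp s, dividing by y turns the claim into exp((r-1)s) +
    (r-1)exp(-s) > r, where exp(x) >= 1 + x bounds both summands, strictly in
    the first one as s <> 0. *)
Lemma powR_gt_tangent (R : realType) (r y : R) :
  1 < r -> 0 <= y -> y != 1 -> 1 + r * (y - 1) < y `^ r.
Proof.
move=> r1; rewrite le_eqVlt => /predU1P[<- _|y0 y1].
  by rewrite powR0 ?gt_eqF; lra.
have [s ys] : exists s, y = expR s by exists (ln y); rewrite lnK.
have s0 : s != 0 by apply: contra_neq y1 => s0; rewrite ys s0 expR0.
have -> : y `^ r = y * expR ((r - 1) * s).
  rewrite /powR gt_eqF// {1}ys expRK [in RHS]ys -expRD.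
  by congr expR; ring.
have h1 : 1 + (r - 1) * s < expR ((r - 1) * s).
  by apply: expR_gt1Dx; rewrite mulf_neq0// subr_eq0 gt_eqF.
have h2 : (r - 1) * (1 + - s) <= (r - 1) * expR (- s).
  by rewrite ler_pM2l ?subr_gt0// expR_ge1Dx.
have yV : y * expR (- s) = 1 by rewrite ys -expRD subrr expR0.
have : y * r < y * (expR ((r - 1) * s) + (r - 1) * expR (- s)).
  by rewrite ltr_pM2l//; lra.
rewrite mulrDr mulrCA yV; lra.
Qed.

(** The tangent of the power at the midpoint m lies strictly below the power
    at s and at t, and its values there average to m^r. *)
Lemma powR_midpoint_lt (R : realType) (r s t : R) :
  1 < r -> 0 <= s -> 0 <= t -> s != t ->
  ((s + t) / 2) `^ r < (s `^ r + t `^ r) / 2.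
Proof.
move=> r1 s0 t0 st; set m := (s + t) / 2.
have m0 : 0 < m.
  suff st0 : 0 < s + t by rewrite divr_gt0.
  rewrite lt0r (addr_ge0 s0 t0) andbT (paddr_eq0 s0 t0).
  by apply: contra_neqN st => /andP[/eqP-> /eqP->].
have sm : s = m * (s / m) by rewrite mulrC divfK// gt_eqF.
have tm : t = m * (t / m) by rewrite mulrC divfK// gt_eqF.
have y0 : 0 <= s / m by rewrite divr_ge0// ltW.
have z0 : 0 <= t / m by rewrite divr_ge0// ltW.
have yz : s / m + t / m = 2.
  by rewrite -mulrDl /m; field; rewrite gt_eqF//; move: m0; rewrite /m; lra.
have y1 : s / m != 1.
  apply: contra_neq st => ym; have zm : t / m = 1 by lra.
  by rewrite sm tm ym zm.
have z1 : t / m != 1 by apply: contra_neq y1 => zm; lra.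
have := powR_gt_tangent r1 y0 y1.
have := powR_gt_tangent r1 z0 z1.
have -> : s `^ r = m `^ r * (s / m) `^ r by rewrite -powRM ?(ltW m0)// -sm.
have -> : t `^ r = m `^ r * (t / m) `^ r by rewrite -powRM ?(ltW m0)// -tm.
move=> h1 h2.
have -> : (m `^ r * (s / m) `^ r + m `^ r * (t / m) `^ r) / 2 =
  m `^ r * (((s / m) `^ r + (t / m) `^ r) / 2) by ring.
rewrite -[ltLHS]mulr1 ltr_pM2l ?powR_gt0//.
have rz : r * (s / m - 1) = - (r * (t / m - 1)).
  by rewrite -mulrN; congr (_ * _); lra.
lra.
Qed.

(** Factor one power out of (p + h)^r = p (p + h)^(r-1) + h (p + h)^(r-1). *)
Lemma powR_superadditive (R : realType) (r p h : R) :
  1 <= r -> 0 <= p -> 0 <= h -> p `^ r + h `^ r <= (p + h) `^ r.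
Proof.
move=> r1 p0 h0; have r0 : 0 < r by lra.
rewrite -!(mulr_powRB1 _ r0) ?addr_ge0// mulrDl.
by apply: lerD; rewrite ler_wpM2l// ge0_ler_powR ?nnegrE//; lra.
Qed.

(** Strict convexity of b |-> |x - b|^r: if x is at the same distance from a and
    b then it is their midpoint, and otherwise the power is strictly convex
    between these distances. *)
Lemma powR_dist_midpoint_lt (R : realType) (r a b x : R) : 1 < r -> a != b ->
  `|x - (a + b) / 2| `^ r < (`|x - a| `^ r + `|x - b| `^ r) / 2.
Proof.
move=> r1 ab; have r0 : 0 < r by lra.
have [xab|xab] := eqVneq `|x - a| `|x - b|.
  have xm : x - (a + b) / 2 = 0.
    move/eqP: xab; rewrite eqr_norm2 => /orP[|] /eqP xab; last by lra.
    by move/eqP : ab; lra.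
  have xa : 0 < `|x - a| by rewrite normr_gt0; apply: contra_neq ab; lra.
  by rewrite xm normr0 powR0 ?gt_eqF// divr_gt0// -xab addr_gt0// powR_gt0.
apply: (le_lt_trans _ (powR_midpoint_lt r1 _ _ xab)) => //.
have -> : x - (a + b) / 2 = ((x - a) + (x - b)) / 2 by field.
rewrite ge0_ler_powR ?nnegrE ?divr_ge0 ?addr_ge0 ?(ltW r0)//.
by rewrite normrM [`|2^-1|]ger0_norm ?invr_ge0// ler_pM2r ?invr_gt0// ler_normD.
Qed.

Lemma powR_distl_le (R : realType) (r x b : R) : 0 <= r ->
  `|x - b| `^ r <= 2 `^ r * (`|x| `^ r + `|b| `^ r).
Proof.
move=> r0; pose m := Num.max `|x| `|b|.
have m0 : 0 <= m by rewrite le_max normr_ge0.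
apply: (@le_trans _ _ ((2 * m) `^ r)).
  rewrite ge0_ler_powR ?nnegrE ?mulr_ge0// (le_trans (ler_normB _ _))//.
  by rewrite mulrDl mul1r lerD// /m le_max lexx ?orbT.
rewrite powRM// ler_wpM2l ?powR_ge0// /m.
by case: (leP `|x| `|b|) => _; rewrite ?lerDl ?lerDr ?powR_ge0.
Qed.

(** * The cost of serving a set from one level *)

(** Equality of the integrals would make the nonnegative function g - f vanish
    almost everywhere on A. *)
Lemma Rintegral_lt d (T : measurableType d) (R : realType)
    (mu : {measure set T -> \bar R}) (A : set T) (f g : T -> R) :
  measurable A -> (0 < mu A)%E ->
  mu.-integrable A (EFin \o f) -> mu.-integrable A (EFin \o g) ->
  (forall x, A x -> f x < g x) ->
  \int[mu]_(x in A) f x < \int[mu]_(x in A) g x.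
Proof.
move=> mA A0 intf intg fg.
have fleg : forall x, A x -> f x <= g x by move=> x /fg/ltW.
rewrite lt_neqAle le_Rintegral// andbT; apply/eqP => fgE.
have intgf : mu.-integrable A (EFin \o (g \- f)).
  exact: (integrableB mA intg intf).
have int0 : (\int[mu]_(x in A) `|(EFin \o (g \- f)%R) x| = 0)%E.
  under eq_integral => x.
    move/set_mem => Ax; rewrite gee0_abs ?lee_fin ?subr_ge0 ?fleg//.
    over.
  rewrite -[LHS]fineK; last exact: integrable_fin_num.
  congr EFin; rewrite -[LHS]/(\int[mu]_(x in A) (g x - f x)).
  by rewrite RintegralB// fgE subrr.
have [/(_ int0) + _] := ae_eq_integral_abs mu mA (measurable_int mu intgf).
move=> [N [mN N0 AN]]; move: A0; rewrite lt_neqAle => /andP[/eqP + _]; apply.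
apply/esym; apply: (subset_measure0 mA mN _ N0) => x Ax.
apply: AN => /= /(_ Ax).
by case => /eqP; rewrite subr_eq0 gt_eqF// fg.
Qed.

Section Cost.
Context {R : realType} (r : R) (mu : probability (measurableTypeR R) R).

Definition cost (A : set R) (b : R) : R := \int[mu]_(x in A) (`|x - b| `^ r).

Context (hr : 1 < r) (hmom : (\int[mu]_x (`|x| `^ r)%:E < +oo)%E).

Let r_gt0 : 0 < r. Proof. exact: lt_trans ltr01 hr. Qed.

Lemma measurable_dist (A : mset R) (b : R) :
  measurable_fun A
    (fun x : measurableTypeR R => `|x - b| `^ r : measurableTypeR R).
Proof.
apply: measurable_funTS.
apply: (measurableT_comp (measurable_powR r)).
by apply: measurableT_comp => //; exact: measurable_funB.
Qed.

Lemma fin_probE (A : mset R) : measurable A ->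
  (fine (mu A))%:E = mu A.
Proof. by move=> mA; rewrite fineK// fin_num_measure. Qed.

Lemma fin_prob_setD (A B : mset R) :
  measurable A -> measurable B -> A `<=` B ->
  fine (mu B) = fine (mu A) + fine (mu (B `\` A)).
Proof.
move=> mA mB AB; have mBA : measurable (B `\` A) by exact: measurableD.
by rewrite -fineD ?fin_num_measure// -measureU ?setDIK// setDUK.
Qed.

(** By subadditivity, finitely many null sets cannot cover the line. *)
Lemma gt0_prob_cover (A : nat -> mset R) n :
  (forall i, (i < n)%N -> measurable (A i)) ->
  (forall x, exists2 i, (i < n)%N & A i x) ->
  exists2 i, (i < n)%N & (0 < mu (A i))%E.
Proof.
move=> mA coverA; apply: contrapT => null.
have A0 i : (i < n)%N -> mu (A i) = 0%E.
  move=> im; apply/eqP; rewrite -measure_le0 leNgt; apply/negP => A0.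
  by apply: null; exists i.
have /= := Boole_inequality mu mA.
rewrite [X in (_ <= X)%E]big1 => [|i _]; last exact: A0.
rewrite -bigcup_mkord (_ : \bigcup_(i < n) A i = setT).
  by rewrite probability_setT lee_fin ler10.
by apply/seteqP; split => // x _; have [i im Aix] := coverA x; exists i.
Qed.

Lemma integrable_dist (A : mset R) (b : R) :
  measurable A ->
  mu.-integrable A (EFin \o (fun x : measurableTypeR R => `|x - b| `^ r)).
Proof.
move=> mA; apply: (@integrableS _ _ _ _ setT) => //.
have int0 : mu.-integrable setT
    (EFin \o (fun x : measurableTypeR R => `|x| `^ r)).
  apply/integrableP; split.
    apply/measurable_EFinP; have := @measurable_dist setT 0.
    by under eq_fun do rewrite subr0.
  under eq_integral do rewrite gee0_abs ?lee_fin ?powR_ge0//.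
  exact: hmom.
have intc := finite_measure_integrable_cst mu (`|b| `^ r) measurableT.
have := integrableZl measurableT (2 `^ r) (integrableD measurableT int0 intc).
apply: le_integrable => //.
  by apply/measurable_EFinP; exact: measurable_dist.
move=> x _ /=; rewrite lee_fin ger0_norm ?powR_ge0//.
by rewrite (le_trans (powR_distl_le _ _ (ltW r_gt0)))// ler_norm.
Qed.

Lemma cost_ge0 A b : 0 <= cost A b.
Proof. by apply: Rintegral_ge0 => x _; exact: powR_ge0. Qed.

Lemma cost_lt (A : mset R) (a b : R) :
  measurable A -> (0 < mu A)%E ->
  (forall x, A x -> `|x - a| < `|x - b|) -> cost A a < cost A b.
Proof.
move=> mA A0 ab.
apply: (Rintegral_lt mA A0 (integrable_dist a mA) (integrable_dist b mA)).
by move=> x Ax; rewrite gt0_ltr_powR ?nnegrE// ab.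
Qed.

Lemma cost_setD (A B : mset R) (b : R) :
  measurable A -> measurable B -> A `<=` B ->
  cost B b = cost A b + cost (B `\` A) b.
Proof.
move=> mA mB AB; have mBA : measurable (B `\` A) by exact: measurableD.
rewrite -{1}(setDUK AB) /cost Rintegral_setU//.
  by apply: integrable_dist; exact: measurableU.
by apply/disj_setPS => x [Ax []].
Qed.

Lemma cost_subset (A B : mset R) (b : R) :
  measurable A -> measurable B -> A `<=` B -> cost A b <= cost B b.
Proof. by move=> mA mB /(cost_setD b mA mB) ->; rewrite lerDl cost_ge0. Qed.

Lemma cost_le0 (A : mset R) (b : R) : measurable A ->
  cost A b <= 2 `^ r * (cost A 0 + `|b| `^ r * fine (mu A)).
Proof.
move=> mA; have i0 := integrable_dist 0 mA.
have ic := finite_measure_integrable_cst mu (`|b| `^ r) mA.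
rewrite -Rintegral_cst// -RintegralD// -RintegralZl//; last first.
  exact: (integrableD mA i0 ic).
apply: le_Rintegral => //.
- exact: integrable_dist.
- exact: (integrableZl mA (2 `^ r) (integrableD mA i0 ic)).
- by move=> x _; rewrite subr0 powR_distl_le// ltW.
Qed.

(** Integrate |b|^r <= 2^r (|x - b|^r + |x|^r) over A: a level far away is
    expensive, which confines the nearly optimal levels to a bounded set. *)
Lemma cost_coercive (A : mset R) (b : R) : measurable A ->
  `|b| `^ r * fine (mu A) <= 2 `^ r * (cost A b + cost A 0).
Proof.
move=> mA; have i0 := integrable_dist 0 mA; have ib := integrable_dist b mA.
have ic := finite_measure_integrable_cst mu (`|b| `^ r) mA.
rewrite -Rintegral_cst// addrC -RintegralD// -RintegralZl//; last first.
  exact: (integrableD mA i0 ib).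
apply: le_Rintegral => //.
- exact: (integrableZl mA (2 `^ r) (integrableD mA i0 ib)).
- move=> x _; rewrite subr0 -[in leLHS](subKr x b).
  by rewrite powR_distl_le// ltW.
Qed.

End Cost.

(** * Optimal levels *)

(** Away from 0 the power is differentiable; at 0 the bound e is met below
    e^(1/r). *)
Lemma continuous_normr_powR (R : realType) (r : R) : 0 < r ->
  continuous (fun t : R => `|t| `^ r).
Proof.
move=> r0 t; have [->|t0] := eqVneq t 0.
  apply/cvgrPdist_lt => /= e e0; rewrite normr0 powR0 ?gt_eqF//.
  near=> u; rewrite sub0r normrN ger0_norm ?powR_ge0//.
  rewrite -(powRr1 (ltW e0)) -(mulVf (lt0r_neq0 r0)) powRrM.
  rewrite gt0_ltr_powR ?nnegrE ?powR_ge0//.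
  near: u; exists (e `^ r^-1); first by rewrite /= powR_gt0.
  by move=> u /=; rewrite sub0r normrN.
have c1 : {for t, continuous (fun u : R => `|u|)} by exact: norm_continuous.
have c2 : {for `|t|, continuous (fun u : R => u `^ r)}.
  apply/differentiable_continuous/derivable1_diffP/derivable_powR.
  by rewrite in_itv/= andbT normr_gt0.
exact: (continuous_comp c1 c2).
Unshelve. all: by end_near. Qed.

Section Minimizer.
Context {R : realType} (r : R) (mu : probability (measurableTypeR R) R).
Context (hr : 1 < r) (hmom : (\int[mu]_x (`|x| `^ r)%:E < +oo)%E).
Implicit Types A B : mset R.

Let r_gt0 : 0 < r. Proof. exact: lt_trans ltr01 hr. Qed.

(** Near a, all the integrands are dominated by one function, integrable by
    the moment assumption. *)
Lemma cost_continuous A : measurable A -> continuous (cost r mu A).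
Proof.
move=> mA a.
pose g := fun x : measurableTypeR R => 2 `^ r * (`|x| `^ r + (`|a| + 1) `^ r).
have intg : mu.-integrable A (EFin \o g).
  have i0 := integrable_dist hr hmom 0 mA.
  have ic := finite_measure_integrable_cst mu ((`|a| + 1) `^ r) mA.
  have := integrableZl mA (2 `^ r) (integrableD mA i0 ic).
  by apply: eq_integrable => // x _ /=; rewrite subr0.
apply: (@continuity_under_integral _ _ _ mu (fun b x => `|x - b| `^ r) A mA
  (a - 1) (a + 1) _ _ g intg) => //.
- by move=> b _; exact: integrable_dist.
- apply: aeW => x Ax b _.
  have c1 : {for b, continuous (fun b : R => x - b)}.
    by apply: cvgB; [exact: cvg_cst|exact: cvg_id].
  have c2 : {for x - b, continuous (fun t : R => `|t| `^ r)}.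
    exact: continuous_normr_powR.
  exact: (continuous_comp c1 c2).
- move=> b; rewrite /= in_itv/= => /andP[ab ba]; apply: aeW => x Ax.
  rewrite ger0_norm ?powR_ge0// (le_trans (powR_distl_le _ _ (ltW r_gt0)))//.
  rewrite ler_pM2l ?powR_gt0// lerD2l ge0_ler_powR ?nnegrE ?addr_ge0// ?ltW//.
  rewrite ltr_norml; have := ler_norm a; have := ler_norm (- a); rewrite normrN.
  by move=> *; apply/andP; split; lra.
- by rewrite inE/= in_itv/=; apply/andP; split; lra.
Qed.

Lemma cost_null A b : measurable A -> mu A = 0%E -> cost r mu A b = 0.
Proof.
move=> mA A0; rewrite /cost /Rintegral null_set_integral//.
by apply/measurable_EFinP; exact: measurable_dist.
Qed.

(** The bound depends on A only through the lower bound m of its measure; this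
    uniformity is what makes the modulus of continuity of the best cost
    uniform. *)
Lemma cost_minimizer_bound A b (m : R) : measurable A ->
  0 < m -> m <= fine (mu A) -> cost r mu A b <= cost r mu A 0 ->
  `|b| `^ r <= 2 `^ r * (2 * cost r mu setT 0) / m.
Proof.
move=> mA m0 mA1 cb; rewrite ler_pdivlMr//.
apply: (@le_trans _ _ (`|b| `^ r * fine (mu A))).
  by rewrite ler_wpM2l ?powR_ge0.
rewrite (le_trans (cost_coercive hr hmom b mA))// ler_pM2l ?powR_gt0//.
have sub0 := cost_subset hr hmom 0 mA measurableT (@subsetT _ A).
by rewrite mulr_natl mulr2n; exact: (lerD (le_trans cb sub0) sub0).
Qed.

(** If A is not negligible, the levels that do at least as well as 0 are
    bounded, so a minimum over a large segment is a global one. *)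
Lemma cost_minimizer_exists A : measurable A ->
  exists a, forall b, cost r mu A a <= cost r mu A b.
Proof.
move=> mA; have [A0|A0] := eqVneq (mu A) 0%E.
  by exists 0 => b; rewrite !cost_null.
have m0 : 0 < fine (mu A).
  by rewrite -lte_fin fin_probE// lt0e A0 measure_ge0.
pose K := 2 `^ r * (2 * cost r mu setT 0) / fine (mu A).
pose C := K `^ r^-1.
have C0 : 0 <= C by exact: powR_ge0.
have bC b : cost r mu A b <= cost r mu A 0 -> `|b| <= C.
  move=> /(cost_minimizer_bound mA m0 (lexx _)); rewrite -/K => bK.
  rewrite -(powRr1 (normr_ge0 b)) -(mulfV (lt0r_neq0 r_gt0)) powRrM.
  have K0 : 0 <= K by rewrite (le_trans _ bK)// powR_ge0.
  by rewrite ge0_ler_powR ?nnegrE ?powR_ge0 ?invr_ge0 ?(ltW r_gt0).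
have CC : - C <= C by lra.
have [|a aC amin] := @EVT_min R (cost r mu A) _ _ CC.
  exact/continuous_subspaceT/cost_continuous.
exists a => b; have [b0|/ltW b0] := leP (cost r mu A b) (cost r mu A 0).
  by apply: amin; rewrite in_itv/= -ler_norml bC.
by apply: le_trans b0; apply: amin; rewrite in_itv/=; lra.
Qed.

(** The midpoint of two distinct optimal levels would be strictly better than
    both. *)
Lemma cost_minimizer_unique A a b : measurable A -> (0 < mu A)%E ->
  (forall c, cost r mu A a <= cost r mu A c) ->
  (forall c, cost r mu A b <= cost r mu A c) -> a = b.
Proof.
have below_mean (x y z : R) : x < (y + z) * 2^-1 -> y <= x -> z <= x -> False.
  by lra.
move=> mA A0 mina minb; apply/eqP/negP => /negP ab.
have ia := integrable_dist hr hmom a mA.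
have ib := integrable_dist hr hmom b mA.
have im := integrable_dist hr hmom ((a + b) / 2) mA.
have iab := integrableZr mA 2^-1 (integrableD mA ia ib).
have := Rintegral_lt mA A0 im iab.
rewrite RintegralZr//; last exact: (integrableD mA ia ib).
rewrite RintegralD// -!/(cost _ _ _ _) => mean_lt.
apply: (below_mean _ _ _ (mean_lt _) (mina _) (minb _)) => x _.
exact: powR_dist_midpoint_lt.
Qed.

End Minimizer.

(** * The best cost of a set *)

Section BestCost.
Context {R : realType} (r : R) (mu : probability (measurableTypeR R) R).

Definition best_cost (A : set R) : R := inf (range (cost r mu A)).

Context (hr : 1 < r) (hmom : (\int[mu]_x (`|x| `^ r)%:E < +oo)%E).
Implicit Types A B : mset R.

Let r_gt0 : 0 < r. Proof. exact: lt_trans ltr01 hr. Qed.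

Lemma best_cost_le A b : best_cost A <= cost r mu A b.
Proof.
by apply: ge_inf; [exists 0 => _ [c _ <-]; exact: cost_ge0|exists b].
Qed.

Lemma best_cost_minimizer A a :
  (forall b, cost r mu A a <= cost r mu A b) -> best_cost A = cost r mu A a.
Proof.
move=> amin; apply/eqP; rewrite eq_le best_cost_le lb_le_inf//.
  by exists (cost r mu A 0), 0.
by move=> _ [b _ <-].
Qed.

Lemma best_cost_ge0 A : 0 <= best_cost A.
Proof.
apply: lb_le_inf; first by exists (cost r mu A 0), 0.
by move=> _ [b _ <-]; exact: cost_ge0.
Qed.

Lemma best_cost_subset A B : measurable A -> measurable B -> A `<=` B ->
  best_cost A <= best_cost B.
Proof.
move=> mA mB AB; have [b bmin] := cost_minimizer_exists hr hmom mB.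
rewrite (best_cost_minimizer bmin) (le_trans (best_cost_le A b))//.
exact: cost_subset.
Qed.

(** If A is not too small, its optimal level a is bounded independently of A,
    and serving B from a costs little more, as the integral of |x - a|^r over
    the small set B \ A is small. If A is small, then so is B, and serving B
    from 0 costs less than e already. *)
Lemma best_cost_modulus (e : R) : 0 < e -> exists2 d : R, 0 < d &
  forall A B, measurable A -> measurable B -> A `<=` B ->
    (mu (B `\` A) < d%:E)%E -> best_cost B <= best_cost A + e.
Proof.
move=> e0.
have small (k : R) : 0 < k -> exists2 d : R, 0 < d &
    forall A, measurable A -> (mu A < d%:E)%E -> cost r mu A 0 < k.
  move=> k0.
  have [d [d0 dP]] := integral_normr_continuous
    (integrable_dist hr hmom 0 measurableT) k0.
  exists d => // A mA /(dP A mA); apply: le_lt_trans.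
  by rewrite /cost; under [leRHS]eq_Rintegral do rewrite ger0_norm ?powR_ge0//.
have [d0 d0_gt0 d0P] := small e e0.
pose m0 := d0 / 2; have m0_gt0 : 0 < m0 by rewrite divr_gt0.
pose K := 2 `^ r * (2 * cost r mu setT 0) / m0.
have K0 : 0 <= K.
  by rewrite divr_ge0 ?(ltW m0_gt0)// !mulr_ge0 ?powR_ge0 ?cost_ge0.
pose k := e / (2 * 2 `^ r).
have k0 : 0 < k by rewrite divr_gt0// mulr_gt0 ?powR_gt0.
have [d1 d1_gt0 d1P] := small k k0.
pose d2 := k / (K + 1); have d2_gt0 : 0 < d2 by rewrite divr_gt0// ltr_wpDl.
(* The measure m0 separates small sets A from the others; K bounds |a|^r for
   the optimal levels a of the latter; d1 and d2 make each of the two terms of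
   the upper bound for the cost over B \ A at most k. *)
exists (Num.min m0 (Num.min d1 d2)); first by rewrite !lt_min m0_gt0 d1_gt0.
move=> A B mA mB AB; have mBA : measurable (B `\` A) by exact: measurableD.
rewrite -(fin_probE mu mBA) lte_fin !lt_min => /and3P[dm0 dd1 dd2].
have [muA|muA] := ltP (fine (mu A)) m0.
  have muB : (mu B < d0%:E)%E.
    rewrite -(fin_probE mu mB) lte_fin (fin_prob_setD mu mA mB AB).
    by move: muA dm0; rewrite /m0; lra.
  have := best_cost_le B 0; have := d0P _ mB muB; have := best_cost_ge0 A.
  by lra.
have [a amin] := cost_minimizer_exists hr hmom mA.
have aK := cost_minimizer_bound hr hmom mA m0_gt0 muA (amin 0).
rewrite (best_cost_minimizer amin) (le_trans (best_cost_le B a))//.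
rewrite (cost_setD hr hmom a mA mB AB) lerD2l.
rewrite (le_trans (cost_le0 hr hmom a mBA))//.
have -> : e = 2 `^ r * (k + k).
  by rewrite /k; field; rewrite gt_eqF// powR_gt0.
rewrite ler_pM2l ?powR_gt0//; apply: lerD.
  by rewrite ltW// d1P// -(fin_probE mu mBA) lte_fin.
apply: (@le_trans _ _ (K * d2)).
  by rewrite ler_pM// ?powR_ge0// ?fine_ge0// ltW.
by rewrite /d2 mulrCA ler_piMr ?(ltW k0)// ler_pdivrMr; lra.
Qed.

End BestCost.

(** * Continuity of the distribution function *)

Section NonatomicCdf.
Context {R : realType} (mu : probability (measurableTypeR R) R).

Definition real_cdf (x : R) : R := fine (mu `]-oo, x]%classic).
Local Notation F := real_cdf.

(** Indexing the cells by values of F rather than by points of the line bounds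
    their measures by w - u, and lets the real numbers 0 and 2 play the role of
    infinite end points. *)
Definition cdf_cell (u w : R) : set R := [set x | u <= F x < w].

Lemma real_cdf_nd : {homo F : x y / x <= y}.
Proof.
move=> x y xy; rewrite fine_le ?fin_num_measure//.
by rewrite le_measure ?inE//; exact: subset_itvl.
Qed.

Lemma real_cdf_measurable :
  measurable_fun setT (F : measurableTypeR R -> measurableTypeR R).
Proof. exact: nondecreasing_measurable (fun x y xy => real_cdf_nd xy). Qed.

Lemma measurable_cdf_cell u w : measurable (cdf_cell u w : mset R).
Proof.
have -> : cdf_cell u w = setT `&` F @^-1` `[u, w[.
  by rewrite setTI; apply/seteqP; split => x /=; rewrite in_itv.
exact: real_cdf_measurable.
Qed.

Let idR : measurableTypeR R -> R := idfun.
#[local] HB.instance Definition _ :=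
  @isMeasurableFun.Build _ _ _ _ idR (@measurable_id _ _ setT).

Lemma real_cdf_cvgy1 : F @ +oo --> (1 : R).
Proof. exact/fine_cvg/(@cvg_cdfy1 _ _ _ mu (idR : {RV mu >-> R})). Qed.

Lemma real_cdf_cvgNy0 : F @ -oo --> (0 : R).
Proof. exact/fine_cvg/(@cvg_cdfNy0 _ _ _ mu (idR : {RV mu >-> R})). Qed.

Context (hpt : forall x : R, mu [set x] = 0%E).

Lemma fin_prob_itv_oc x y : x <= y -> fine (mu `]x, y]%classic) = F y - F x.
Proof.
move=> xy.
rewrite /F (@fin_prob_setD _ mu `]-oo, x]%classic `]-oo, y]%classic)//.
  rewrite addrC addKr; congr (fine (mu _)); apply/seteqP; split => z /=.
    rewrite !in_itv/= => /andP[xz ->]; split => //.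
    by apply/negP; rewrite -ltNge.
  by rewrite !in_itv/= => -[-> /negP]; rewrite -ltNge => ->.
exact: subset_itvl.
Qed.

(** The segments [x - 1/n, x + 1/n] decrease to the null set {x}. *)
Lemma small_prob_itv x (e : R) : 0 < e ->
  exists2 h : R, 0 < h & (mu `[(x - h)%R, (x + h)%R]%classic < e%:E)%E.
Proof.
move=> e0.
pose S n : set R := `[x - n.+1%:R^-1, x + n.+1%:R^-1]%classic.
have mS n : measurable (S n : mset R) by exact: measurable_itv.
have S0 : \bigcap_n S n = [set x].
  apply/seteqP; split => [y Sy|_ -> n _]; last first.
    have : 0 <= n.+1%:R^-1 :> R by rewrite invr_ge0.
    by rewrite /S /= in_itv/=; move: (n.+1%:R^-1) => d d0; lra.
  apply/eqP; rewrite -subr_eq0 -normr_le0; apply/ler_addgt0Pr => d d0.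
  rewrite add0r; have [n _ nd] := near_infty_natSinv_lt (PosNum d0).
  have := Sy n I; rewrite /S/= in_itv/=.
  move: (n.+1%:R^-1) (nd n (leqnn n)) => c cd Sn.
  by rewrite /= in cd; rewrite ler_norml; lra.
have : mu (S n) @[n --> \oo] --> mu (\bigcap_n S n).
  apply: nonincreasing_cvg_mu => //.
  - by rewrite -ge0_fin_numE ?fin_num_measure.
  - by rewrite S0; exact: measurable_set1.
  - move=> m n mn; apply/subsetPset; apply: subset_itv; rewrite bnd_simp.
      by rewrite lerD2l lerN2 lef_pV2 ?posrE// ler_nat.
    by rewrite lerD2l lef_pV2 ?posrE// ler_nat.
rewrite S0 hpt => /fine_cvgP[_ /cvgrPdist_lt/(_ e e0)[N _ /(_ N (leqnn N))]].
rewrite /= sub0r normrN ger0_norm ?fine_ge0// => SNe.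
by exists N.+1%:R^-1; rewrite ?invr_gt0// -(fin_probE mu (mS N)) lte_fin.
Qed.

Lemma real_cdf_continuous : continuous F.
Proof.
move=> x; apply/cvgrPdist_lt => /= e e0.
have [h h0 he] := small_prob_itv x e0.
have mI : measurable (`[x - h, x + h]%classic : mset R).
  exact: measurable_itv.
have close y z : x - h <= y -> y <= z -> z <= x + h -> F z - F y < e.
  move=> xy yz zx; rewrite -fin_prob_itv_oc// -lte_fin fin_probE//.
  apply: le_lt_trans he; rewrite le_measure ?inE//.
  by move=> t /=; rewrite !in_itv/=; lra.
exists h => // y /=; rewrite ltr_norml => /andP[xy yx].
have [xley|/ltW ylex] := leP x y.
  have := real_cdf_nd xley; have : F y - F x < e by apply: close; lra.
  by move=> *; rewrite ltr_norml; lra.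
have := real_cdf_nd ylex; have : F x - F y < e by apply: close; lra.
by move=> *; rewrite ltr_norml; lra.
Qed.

End NonatomicCdf.

(** * Cells cut out by the distribution function *)

Section CdfCells.
Context {R : realType} (mu : probability (measurableTypeR R) R).
Context (hpt : forall x : R, mu [set x] = 0%E).
Local Notation F := (real_cdf mu).
Local Notation cell := (cdf_cell mu).

Lemma real_cdf_ge0 x : 0 <= F x.
Proof. exact: fine_ge0. Qed.

Lemma real_cdf_le1 x : F x <= 1.
Proof. by rewrite -lee_fin fin_probE// probability_le1. Qed.

(** Continuity makes {F >= u} closed, and the intermediate value theorem
    forces F = u at its infimum. *)
Lemma cdf_upset u x y : F x < u -> u <= F y ->
  exists2 s, F s = u & [set t | u <= F t] = `[s, +oo[%classic.
Proof.
move=> Fxu uFy; set E := [set t | u <= F t].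
have lbE t : E t -> x <= t.
  move=> Et; rewrite leNgt; apply/negP => /ltW/(real_cdf_nd mu).
  by move: Et; rewrite /E/=; lra.
have infE : has_inf E by split; [exists y|exists x].
have uFs : u <= F (inf E).
  rewrite leNgt; apply/negP => Fsu.
  have /cvgrPdist_lt := @real_cdf_continuous _ mu hpt (inf E).
  have e0 : 0 < u - F (inf E) by lra.
  move=> /(_ _ e0)[d /= d0 dP].
  have [t Et td] := inf_adherent d0 infE.
  have st : inf E <= t by apply: ge_inf => //; exists x.
  have : `|inf E - t| < d by rewrite ltr_norml; lra.
  by move=> /dP; rewrite ltr_norml; move: Et; rewrite /E/=; lra.
exists (inf E).
  apply/le_anti; rewrite uFs andbT.
  have xy : x <= y by exact: lbE.
  have [||s _ Fs] := @IVT R F x y u xy.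
  - exact/continuous_subspaceT/real_cdf_continuous.
  - by have := real_cdf_nd mu xy; rewrite ge_min le_max; lra.
  by rewrite -Fs real_cdf_nd// ge_inf//; [exists x|rewrite /E/= Fs].
apply/seteqP; split => t /=; rewrite in_itv/= andbT.
  by move=> Et; rewrite ge_inf//; exists x.
by move=> st; rewrite /E/= (le_trans uFs)// real_cdf_nd.
Qed.

Lemma fin_prob_itv_cy s : fine (mu `[s, +oo[%classic) = 1 - F s.
Proof.
have m1 : measurable (`]-oo, s]%classic : mset R).
  exact: measurable_itv.
have m2 : measurable (`[s, +oo[%classic : mset R).
  exact: measurable_itv.
have m3 : measurable ([set s] : mset R) by exact: measurable_set1.
have := fin_prob_setD mu m1 measurableT (@subsetT _ _).
have -> : [set: R] `\` `]-oo, s]%classic = `[s, +oo[%classic `\` [set s].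
  apply/seteqP; split => t /=; rewrite !in_itv/= ?andbT.
    move=> [_ /negP]; rewrite -ltNge => st; split; first exact: ltW.
    by apply/eqP; rewrite gt_eqF.
  move=> [st /eqP ts]; split => //; apply/negP; rewrite -ltNge.
  by rewrite lt_neqAle eq_sym ts.
have s2 : [set s] `<=` `[s, +oo[%classic.
  by move=> _ -> /=; rewrite in_itv/= lexx.
have := fin_prob_setD mu m3 m2 s2.
rewrite hpt probability_setT /= add0r /F => <- ->.
by rewrite addrAC subrr add0r.
Qed.

Lemma real_cdf_lt_exists u : 0 < u -> exists x, F x < u.
Proof.
move=> u0; have := @real_cdf_cvgNy0 _ mu.
move=> /cvgrPdist_lt/(_ _ u0)[M [_ /(_ (M - 1))]].
rewrite /= sub0r normrN ger0_norm ?real_cdf_ge0// => FM.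
by exists (M - 1); apply: FM; lra.
Qed.

Lemma real_cdf_ge_exists u : u < 1 -> exists y, u <= F y.
Proof.
move=> u1; have u10 : 0 < 1 - u by lra.
have := @real_cdf_cvgy1 _ mu => /cvgrPdist_lt/(_ _ u10)[M [_ /(_ (M + 1))]].
rewrite /= => FM; exists (M + 1).
have /FM : M < M + 1 by lra.
by rewrite ltr_norml; lra.
Qed.

(** The three cases are those where {F >= u} is empty, the whole line, or a
    half-line [s, +oo) with F s = u. *)
Lemma prob_cdf_upset u : let H := fine (mu [set t | u <= F t]) in
  [\/ H = 0 /\ 1 <= u, H = 1 /\ u <= 0 | H = 1 - u /\ 0 <= u <= 1].
Proof.
move=> H; have [[x Fxu]|noFu] := pselect (exists x, F x < u); last first.
  apply: Or32; split; last first.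
    by rewrite leNgt; apply/negP => /real_cdf_lt_exists.
  rewrite /H (_ : [set t | _] = setT) ?probability_setT//.
  apply/seteqP; split => t _ //=.
  by rewrite leNgt; apply/negP => Ftu; apply: noFu; exists t.
have [[y uFy]|nouF] := pselect (exists y, u <= F y); last first.
  apply: Or31; split; last first.
    by rewrite leNgt; apply/negP => /real_cdf_ge_exists.
  rewrite /H (_ : [set t | _] = set0) ?measure0//.
  by apply/seteqP; split => t //= ut; apply: nouF; exists t.
have [s Fs sE] := cdf_upset Fxu uFy.
apply: Or33; split; last by rewrite -Fs real_cdf_ge0 real_cdf_le1.
by rewrite /H sE fin_prob_itv_cy Fs.
Qed.

Lemma measurable_upset u : measurable ([set t | u <= F t] : mset R).
Proof.
have -> : [set t | u <= F t] = setT `&` F @^-1` `[u, +oo[%classic.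
  by rewrite setTI; apply/seteqP; split => x /=; rewrite in_itv/= andbT.
exact: real_cdf_measurable.
Qed.

Lemma prob_cdf_cell_le u w : u <= w -> fine (mu (cell u w)) <= w - u.
Proof.
move=> uw.
have sub : [set t | w <= F t] `<=` [set t | u <= F t].
  by move=> t /=; exact: le_trans.
have := fin_prob_setD mu (measurable_upset w) (measurable_upset u) sub.
have -> : [set t | u <= F t] `\` [set t | w <= F t] = cell u w.
  apply/seteqP; split => t /=.
    by move=> [ut /negP]; rewrite -ltNge => tw; apply/andP.
  by move=> /andP[ut tw]; split => //; apply/negP; rewrite -ltNge.
case: (prob_cdf_upset u) => -[-> ?];
  by case: (prob_cdf_upset w) => -[-> ?]; lra.
Qed.

End CdfCells.

Section CellCost.
Context {R : realType} (r : R) (mu : probability (measurableTypeR R) R).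
Context (hpt : forall x : R, mu [set x] = 0%E).
Context (hr : 1 < r) (hmom : (\int[mu]_x (`|x| `^ r)%:E < +oo)%E).
Local Notation cell := (cdf_cell mu).
Local Notation V u w := (best_cost r mu (cell u w)).

Lemma cell_cost_mono u u' w w' : u' <= u -> w <= w' -> V u w <= V u' w'.
Proof.
move=> uu ww; apply: best_cost_subset => //; try exact: measurable_cdf_cell.
by move=> t /andP[ut tw]; apply/andP; split; lra.
Qed.

Lemma cell_cost_diag u : V u u = 0.
Proof.
have -> : cell u u = set0.
  by apply/seteqP; split => t // /andP[]; lra.
have c0 b : cost r mu set0 b = 0 by rewrite /cost Rintegral_set0.
have min0 b : cost r mu set0 0 <= cost r mu set0 b by rewrite !c0.
by rewrite (best_cost_minimizer min0) c0.
Qed.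

(** The larger cell exceeds the smaller one by the cells [u', u) and [w, w'),
    of measure at most u - u' and w' - w. *)
Lemma cell_cost_modulus (e : R) : 0 < e -> exists2 d : R, 0 < d &
  forall u u' w w', u' <= u -> w <= w' -> (u - u') + (w' - w) < d ->
    V u' w' <= V u w + e.
Proof.
move=> e0; have [d d0 dP] := best_cost_modulus hr hmom e0.
exists d => // u u' w w' uu ww uw.
have mc := @measurable_cdf_cell _ mu.
have mD : measurable (cell u' w' `\` cell u w : mset R).
  exact: measurableD.
apply: dP => //.
  by move=> t /andP[ut tw]; apply/andP; split; lra.
have mU : measurable (cell u' u `|` cell w w' : mset R).
  exact: measurableU.
apply: (@le_lt_trans _ _ (mu (cell u' u `|` cell w w'))).
  rewrite le_measure ?inE// => t [/andP[ut tw] /negP].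
  rewrite negb_and -!ltNge -leNgt.
  by move=> /orP[tu|wt]; [left|right]; apply/andP.
have := @measureU2 _ _ _ mu _ _ (mc u' u) (mc w w').
have -> : (mu (cell u' u) + mu (cell w w') =
    (fine (mu (cell u' u)) + fine (mu (cell w w')))%:E)%E.
  by rewrite EFinD !fin_probE.
move=> /le_lt_trans; apply; rewrite lte_fin.
by apply: le_lt_trans uw; apply: lerD; exact: prob_cdf_cell_le.
Qed.

End CellCost.

(** * Optimality and the position of optimal levels *)

Section Optimality.
Context {R : realType} (r : R) (mu : probability (measurableTypeR R) R).
Context (hpt : forall x : R, mu [set x] = 0%E).
Context (hr : 1 < r) (hmom : (\int[mu]_x (`|x| `^ r)%:E < +oo)%E).
Implicit Types A B : mset R.

Let r_gt0 : 0 < r. Proof. exact: lt_trans ltr01 hr. Qed.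

Lemma EFin_cost A b : measurable A ->
  (\int[mu]_(x in A) (`|x - b| `^ r)%:E)%E = (cost r mu A b)%:E.
Proof.
move=> mA; rewrite /cost /Rintegral fineK//.
exact: (integrable_fin_num mA (integrable_dist hr hmom b mA)).
Qed.

Lemma integral_cond_prob A b : measurable A ->
  (\int[cond_prob mu A]_x (`|x - b| `^ r)%:E)%E =
  ((fine (mu A))^-1 * cost r mu A b)%:E.
Proof.
move=> mA.
have k0 : 0 <= (fine (mu A))^-1 by rewrite invr_ge0 fine_ge0.
have mf (D : mset R) : measurable_fun D
    (fun x : measurableTypeR R => (`|x - b| `^ r)%:E).
  by apply/measurable_EFinP; exact: measurable_dist.
have f0 (x : measurableTypeR R) : (0 <= (`|x - b| `^ r)%:E)%E.
  by rewrite lee_fin powR_ge0.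
rewrite (_ : cond_prob mu A = mscale (NngNum k0) (mrestr mu mA)); last first.
  by apply/funext => B; rewrite /cond_prob /mscale /mrestr muleC.
rewrite ge0_integral_mscale// EFinM; congr (_ * _)%E.
rewrite (@ge0_negligible_integral _ _ _ _ setT (~` A))//; last 2 first.
- exact: measurableC.
- by transitivity (mu (~` A `&` A)); rewrite // setICl measure0.
rewrite setTD setCK -EFin_cost//.
apply: eq_measure_integral => B mB BA.
by rewrite /mrestr; congr (mu _); exact/setIidPl.
Qed.

(** Conditioning on A divides all costs by the same positive number. *)
Lemma optimal_cond_probP A a : measurable A -> (0 < mu A)%E ->
  (\int[cond_prob mu A]_x (`|x - a| `^ r)%:E =
    ereal_inf (range (fun b : R =>
      \int[cond_prob mu A]_x (`|x - b| `^ r)%:E)))%E <->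
  (forall b, cost r mu A a <= cost r mu A b).
Proof.
move=> mA A0; have m0 : 0 < (fine (mu A))^-1.
  by rewrite invr_gt0 -lte_fin fin_probE.
split=> [aE b|amin].
  rewrite -(ler_pM2l m0) -lee_fin.
  rewrite -(integral_cond_prob a mA) -(integral_cond_prob b mA) aE.
  by apply: ereal_inf_lbound; exists b.
apply/le_anti/andP; split; last by apply: ereal_inf_lbound; exists a.
apply: le_ereal_inf_tmp => _ [b _ <-].
rewrite (integral_cond_prob a mA) (integral_cond_prob b mA).
by rewrite lee_fin (ler_pM2l m0).
Qed.

(** The point b, where the integrand vanishes, is negligible. *)
Lemma cost_gt0 A b : measurable A -> (0 < mu A)%E -> 0 < cost r mu A b.
Proof.
move=> mA A0.
have mb : measurable ([set b] : mset R) by exact: measurable_set1.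
have mAb : measurable (A `\` [set b]) by exact: measurableD.
have Ab0 : (0 < mu (A `\` [set b]))%E.
  rewrite lt0e measure_ge0 andbT; apply: contraTneq A0 => Ab.
  have Asub : A `<=` [set b] `|` (A `\` [set b]).
    by move=> x Ax; have [xb|/eqP xb] := eqVneq x b; [left|right].
  have mU := measurableU _ _ mb mAb.
  rewrite -leNgt; apply: (@le_trans _ _ (mu ([set b] `|` (A `\` [set b])))).
    by rewrite le_measure ?inE.
  have := measureU2 mu mb mAb.
  by rewrite (_ : (mu [set b] + mu (A `\` [set b]))%E = 0%E)// Ab hpt adde0.
apply: lt_le_trans (cost_subset hr hmom b mAb mA (@subDsetl _ _ _)).
have <- : \int[mu]_(x in A `\` [set b]) (fun=> 0) x = 0.
  by rewrite Rintegral_cst// mul0r.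
apply: Rintegral_lt => //.
- exact: finite_measure_integrable_cst.
- exact: integrable_dist.
- by move=> x [_ /eqP xb]; rewrite powR_gt0// normr_gt0 subr_eq0.
Qed.

Lemma best_cost_gt0 A : measurable A -> (0 < mu A)%E -> 0 < best_cost r mu A.
Proof.
move=> mA A0; have [a amin] := cost_minimizer_exists hr hmom mA.
by rewrite (best_cost_minimizer amin) cost_gt0.
Qed.

(** If a < t then t is closer than a to all points of A. *)
Lemma minimizer_ge A t a : measurable A -> (0 < mu A)%E ->
  (forall x, A x -> t <= x) -> (forall b, cost r mu A a <= cost r mu A b) ->
  t <= a.
Proof.
move=> mA A0 tA amin; rewrite leNgt; apply/negP => at_.
have := amin t; rewrite leNgt => /negP; apply; apply: cost_lt => // x /tA tx.
by rewrite !ger0_norm; lra.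
Qed.

(** If a >= t, then moving the level from a to t - h saves at least h^r at the
    points of A below t - h, by superadditivity of the power, and loses at
    most h^r at those of [t - h, t). For small h the first set carries more
    than half of the mass of A. *)
Lemma minimizer_lt A t a : measurable A -> (0 < mu A)%E ->
  (forall x, A x -> x < t) -> (forall b, cost r mu A a <= cost r mu A b) ->
  a < t.
Proof.
have balance (x1 x2 y1 y2 p q : R) : x1 + p <= y1 -> x2 <= q -> q < p ->
    0 <= y2 -> y1 + y2 <= x1 + x2 -> False by lra.
move=> mA A0 At amin; rewrite ltNge; apply/negP => ta.
have m0 : 0 < fine (mu A) / 2 by rewrite divr_gt0// -lte_fin fin_probE.
have [h h0 hsmall] := small_prob_itv hpt t m0.
have gain x : x < t - h -> `|x - (t - h)| + h <= `|x - a|.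
  by move=> xth; rewrite !ler0_norm; lra.
have loss x : x < t -> t - h <= x -> `|x - (t - h)| <= h.
  by move=> xt xth; rewrite ger0_norm; lra.
pose L := A `&` `]-oo, t - h[%classic.
have notL x : A x -> ~ L x -> t - h <= x.
  move=> Ax nLx; rewrite leNgt; apply/negP => xth; apply: nLx.
  by split => //=; rewrite in_itv.
have mI : measurable (`]-oo, t - h[%classic : mset R).
  exact: measurable_itv.
have mL : measurable L by exact: measurableI.
have LA : L `<=` A by exact: subIsetl.
have mAL : measurable (A `\` L) by exact: measurableD.
have mh : measurable (`[t - h, t + h]%classic : mset R).
  exact: measurable_itv.
have Alarge := fin_prob_setD mu mL mA LA.
have ALsmall : fine (mu (A `\` L)) < fine (mu L).
  suff : fine (mu (A `\` L)) < fine (mu A) / 2 by lra.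
  rewrite -lte_fin fin_probE//; apply: le_lt_trans hsmall.
  rewrite le_measure ?inE// => x [Ax nLx] /=; rewrite in_itv/= notL//=.
  by have := At _ Ax; lra.
have hr0 : 0 < h `^ r by rewrite powR_gt0.
have ic D (mD : measurable D) := finite_measure_integrable_cst mu (h `^ r) mD.
have id D b (mD : measurable D) := integrable_dist hr hmom b mD.
have costL : cost r mu L (t - h) + h `^ r * fine (mu L) <= cost r mu L a.
  rewrite -(Rintegral_cst mu mL) -(RintegralD mL (id _ _ mL) (ic _ mL)).
  apply: (le_Rintegral mL _ (id _ _ mL)).
    exact: (integrableD mL (id L (t - h) mL) (ic L mL)).
  move=> x [Ax /=]; rewrite in_itv/= => /gain xth.
  apply: le_trans (powR_superadditive (ltW hr) (normr_ge0 _) (ltW h0)) _.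
  by rewrite ge0_ler_powR ?nnegrE ?addr_ge0 ?(ltW h0) ?(ltW r_gt0).
have costR : cost r mu (A `\` L) (t - h) <= h `^ r * fine (mu (A `\` L)).
  rewrite -(Rintegral_cst mu mAL).
  apply: (le_Rintegral mAL (id _ _ mAL) (ic _ mAL)) => x [Ax nLx].
  rewrite ge0_ler_powR ?nnegrE ?(ltW h0) ?(ltW r_gt0)//.
  by apply: loss; [exact: At|exact: notL].
have := amin (t - h).
rewrite (cost_setD hr hmom _ mL mA LA) (cost_setD hr hmom (t - h) mL mA LA).
apply: balance costL costR _ _; last exact: cost_ge0.
by rewrite ltr_pM2l.
Qed.

End Optimality.

(** * Splitting into pieces of equal cost *)

(** For a nondecreasing function, a one-sided modulus is a uniform one. *)
Lemma nd_modulus_continuous (R : realType) (f : R -> R) :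
  {homo f : x y / x <= y} ->
  (forall e, 0 < e -> exists2 d, 0 < d &
    forall x y, x <= y -> y - x < d -> f y <= f x + e) ->
  continuous f.
Proof.
move=> fnd fmod x; apply/cvgrPdist_lt => /= e e0.
have e20 : 0 < e / 2 by rewrite divr_gt0.
have [d d0 dP] := fmod _ e20.
exists d => // y /=; rewrite ltr_norml => /andP[xy yx].
have [xley|/ltW ylex] := leP x y.
  have := fnd _ _ xley; have : f y <= f x + e / 2 by apply: dP; lra.
  by move=> *; rewrite ltr_norml; lra.
have := fnd _ _ ylex; have : f x <= f y + e / 2 by apply: dP; lra.
by move=> *; rewrite ltr_norml; lra.
Qed.

(** The function W is the common cost as a function of the right end point. It
    is nondecreasing and inherits the modulus of V: when the right end point
    moves from x to y, either the last cut moves to the left and W does not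
    grow, or the last cell only grows at its right end. Both properties are
    needed again in the induction, to solve W s = V s w for the next cut s. *)
Lemma equal_split (R : realType) (V : R -> R -> R) :
  (forall u u' w w', u' <= u -> w <= w' -> V u w <= V u' w') ->
  (forall u, V u u = 0) ->
  (forall e, 0 < e -> exists2 d, 0 < d &
    forall u u' w w', u' <= u -> w <= w' -> (u - u') + (w' - w) < d ->
      V u' w' <= V u w + e) ->
  forall n, exists W : R -> R,
  [/\ {homo W : x y / x <= y},
      forall e, 0 < e -> exists2 d, 0 < d &
        forall x y, x <= y -> y - x < d -> W y <= W x + e,
      W 0 = 0 &
      forall w, 0 <= w -> exists c : nat -> R,
        [/\ c 0%N = 0, c n.+1 = w, forall i, (i <= n)%N -> c i <= c i.+1 &
            forall i, (i <= n)%N -> V (c i) (c i.+1) = W w]].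
Proof.
move=> Vmono Vdiag Vmod.
(* Right end points below 0 count as 0, so that W is defined and nondecreasing
   on the whole line. *)
pose pos (w : R) := Num.max 0 w.
have pos_ge0 w : 0 <= pos w by rewrite /pos le_max lexx.
have pos_id w : 0 <= w -> pos w = w by move=> w0; rewrite /pos max_r.
have pos_nd x y : x <= y -> pos x <= pos y.
  by move=> xy; rewrite /pos; case: (leP 0 x); case: (leP 0 y); lra.
have pos_lip x y d : x <= y -> y - x < d -> pos y - pos x < d.
  by move=> xy; rewrite /pos; case: (leP 0 x); case: (leP 0 y); lra.
elim=> [|n [W [Wnd Wmod W0 Wc]]].
  exists (fun w => V 0 (pos w)); split => //.
  - by move=> x y xy; apply: Vmono => //; exact: pos_nd.
  - move=> e /Vmod[d d0 dP]; exists d => // x y xy yxd.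
    by apply: dP => //; [exact: pos_nd|rewrite subrr add0r pos_lip].
  - by rewrite pos_id.
  - move=> w w0; exists (fun i => if i is 0%N then 0 else w); split => //.
      by case.
    by case=> // _; rewrite pos_id.
have root w : exists s, 0 <= s <= pos w /\ W s = V s (pos w).
  have w0 := pos_ge0 w; move: (pos w) w0 => {}w w0.
  pose g s := W s - V s w.
  have gc : continuous g.
    apply: nd_modulus_continuous => [x y xy|e e0].
      by have := Wnd _ _ xy; have := Vmono _ _ _ _ xy (lexx w); rewrite /g; lra.
    have e20 : 0 < e / 2 by rewrite divr_gt0.
    have [d1 d10 d1P] := Wmod _ e20; have [d2 d20 d2P] := Vmod _ e20.
    exists (Num.min d1 d2); first by rewrite lt_min d10.
    move=> x y xy; rewrite lt_min => /andP[yx1 yx2].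
    have := d1P _ _ xy yx1; have := d2P _ _ _ _ xy (lexx w).
    by rewrite /g subrr addr0 => /(_ yx2); lra.
  have [||s] := @IVT R g 0 w 0 w0.
  - exact/continuous_subspaceT.
  - rewrite /g W0 Vdiag; have := Wnd _ _ w0; have := Vmono _ _ _ _ (lexx 0) w0.
    by rewrite Vdiag ge_min le_max W0; lra.
  by rewrite in_itv/= => sw /eqP; rewrite subr_eq0 => /eqP Ws; exists s.
have [s sP] := choice root.
exists (fun w => W (s w)); split.
- move=> x y xy; have [_ Wx] := sP x; have [_ Wy] := sP y.
  have [sxy|/ltW syx] := leP (s x) (s y); first exact: Wnd.
  by rewrite Wx Wy; apply: Vmono => //; exact: pos_nd.
- move=> e e0; have [d d0 dP] := Vmod _ e0; exists d => // x y xy yxd.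
  have [_ Wx] := sP x; have [_ Wy] := sP y.
  have [syx|/ltW sxy] := leP (s y) (s x).
    by have := Wnd _ _ syx; lra.
  rewrite Wx Wy (le_trans (Vmono _ _ _ _ sxy (lexx _)))//.
  by apply: dP => //; [exact: pos_nd|rewrite subrr add0r pos_lip].
- have [] := sP 0; rewrite pos_id// => s0 _.
  by rewrite (_ : s 0 = 0)//; lra.
move=> w w0; have [] := sP w; rewrite pos_id// => /andP[s0 sw] Ws.
have [c [c0 cn cnd cV]] := Wc _ s0.
exists (fun i => if (i <= n.+1)%N then c i else w); split => //.
- by rewrite ltnn.
- move=> i i_n1; have [->|i_n] := eqVneq i n.+1; first by rewrite leqnn ltnn cn.
  have {}i_n : (i <= n)%N by rewrite -ltnS ltn_neqAle i_n.
  by rewrite i_n1 ltnS i_n cnd.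
- move=> i i_n1; have [->|i_n] := eqVneq i n.+1.
    by rewrite leqnn ltnn cn -Ws.
  have {}i_n : (i <= n)%N by rewrite -ltnS ltn_neqAle i_n.
  by rewrite i_n1 ltnS i_n cV.
Qed.

(** * Existence *)

Section EqualSplitQuantizer.
Context {R : realType} (r : R) (mu : probability (measurableTypeR R) R).
Context (hpt : forall x : R, mu [set x] = 0%E).
Context (hr : 1 < r) (hmom : (\int[mu]_x (`|x| `^ r)%:E < +oo)%E).
Context (m : nat) (c : nat -> R) (v : R).
Context (c_first : c 0%N = 0) (c_last : c m.+1 = 2).
Context (c_nd : forall i, (i <= m)%N -> c i <= c i.+1).
Local Notation F := (real_cdf mu).
Local Notation C i := (cdf_cell mu (c i) (c i.+1)).
Context (c_cost : forall i, (i <= m)%N -> best_cost r mu (C i) = v).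

Let c_mono i j : (i <= j)%N -> (j <= m.+1)%N -> c i <= c j.
Proof.
move=> ij; elim: j ij => [|j IH]; first by rewrite leqn0 => /eqP ->.
rewrite leq_eqVlt => /predU1P[->//|]; rewrite ltnS => ij jm.
by rewrite (le_trans (IH ij (ltnW jm)))// c_nd.
Qed.

Let cell_cover x : exists2 i, (i <= m)%N & C i x.
Proof.
have : F x < c m.+1 by rewrite c_last; have := real_cdf_le1 mu x; lra.
have : (m.+1 <= m.+1)%N by [].
elim: {-2}m.+1 => [|k IH km Fk].
  by rewrite c_first; have := real_cdf_ge0 mu x; lra.
have [Fck|cFk] := ltP (F x) (c k); first exact: IH (ltnW km) Fck.
by exists k => //; apply/andP.
Qed.

Let cell_inj i j x : (i <= m)%N -> (j <= m)%N -> C i x -> C j x -> i = j.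
Proof.
wlog ij : i j / (i <= j)%N.
  by move=> H im jm Cix Cjx; have [/H->//|/ltnW/H->//] := leqP i j.
move=> im jm /andP[_ Fi] /andP[Fj _]; apply/eqP; rewrite eqn_leq ij leqNgt /=.
apply/negP => ltij; have := c_mono ltij (leqW jm); lra.
Qed.

Let mC i : measurable (C i : mset R).
Proof. exact: measurable_cdf_cell. Qed.

Let v_gt0 : 0 < v.
Proof.
rewrite ltNge; apply/negP => v0.
have [x|i im mC0] := gt0_prob_cover (n := m.+1) mu (fun i _ => mC i).
  exact: cell_cover.
by have := best_cost_gt0 hpt hr hmom (mC i) mC0; rewrite c_cost//; lra.
Qed.

Let cell_gt0 i : (i <= m)%N -> (0 < mu (C i))%E.
Proof.
move=> im; rewrite lt0e measure_ge0 andbT; apply/eqP => C0.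
have := c_cost im; rewrite (@best_cost_minimizer _ r mu _ 0) => [|b].
  by rewrite cost_null//; have := v_gt0; lra.
by rewrite !cost_null.
Qed.

Let cell_neq0 i : (i <= m)%N -> exists x, C i x.
Proof.
move=> /cell_gt0 C0; apply: contrapT => Cempty.
move: C0; rewrite (_ : C i = set0) ?measure0 ?ltxx//.
by apply/seteqP; split => x // Cx; apply: Cempty; exists x.
Qed.

Let cut k : (0 < k <= m)%N -> exists s, forall t, c k <= F t <-> s <= t.
Proof.
case: k => // k /= km.
have [x /andP[_ Fx]] := cell_neq0 (ltnW km).
have [y /andP[Fy _]] := cell_neq0 km.
have [s _ sE] := cdf_upset hpt Fx Fy; exists s => t.
have : [set t | c k.+1 <= F t] t <-> `[s, +oo[%classic t by rewrite sE.
by rewrite /= in_itv/= andbT.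
Qed.

Let centers : exists a : nat -> R, forall i b,
  cost r mu (C i) (a i) <= cost r mu (C i) b.
Proof.
have /choice[a aP] i :
    exists a, forall b, cost r mu (C i) a <= cost r mu (C i) b.
  exact: cost_minimizer_exists.
by exists a.
Qed.

(** The quantizer sends each cell to its optimal level; it is nondecreasing,
    hence measurable, and injective on cells because the levels increase. *)
Lemma equal_split_quantizer : gersho_quantizers m.+1 mu r !=set0.
Proof.
have [a amin] := centers.
have a_step i : (i < m)%N -> a i < a i.+1.
  move=> im; have [|s belongs] := @cut i.+1; first by rewrite /= im.
  apply: (@lt_le_trans _ _ s).
    apply: (minimizer_lt hpt hr hmom (mC i) (cell_gt0 (ltnW im)) _ (amin i)).
    move=> x /andP[_ Fx]; rewrite ltNge; apply/negP => /belongs.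
    by rewrite leNgt Fx.
  apply: (minimizer_ge hr hmom (mC i.+1) (cell_gt0 im) _ (amin i.+1)).
  by move=> x /andP[/belongs].
have a_lt i j : (i < j)%N -> (j <= m)%N -> a i < a j.
  elim: j => // j IH; rewrite ltnS leq_eqVlt => /predU1P[->|ij] jm.
    exact: a_step.
  exact: lt_trans (IH ij (ltnW jm)) (a_step _ jm).
have a_inj i j : (i <= m)%N -> (j <= m)%N -> a i = a j -> i = j.
  by move=> im jm aij; have [/a_lt/(_ jm)|/a_lt/(_ im)|//] := ltngtP i j;
    rewrite aij ltxx.
have /choice[idx idxP] x : exists i, (i <= m)%N /\ C i x.
  by have [i im Cx] := cell_cover x; exists i.
pose q x := a (idx x).
have cellE i : (i <= m)%N -> codecell q (a i) = C i.
  move=> im; apply/seteqP; split => x; have [xm Cx] := idxP x.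
    by rewrite /codecell /q /= => /(a_inj _ _ xm im) <-.
  by move=> Cix; rewrite /codecell /q /= (cell_inj im xm Cix Cx).
have q_range : range q = a @` `I_m.+1.
  apply/seteqP; split => [_ [x _ <-]|_ [i /= im <-]].
    by have [xm _] := idxP x; exists (idx x).
  have [x Cx] := cell_neq0 im; exists x => //; have [xm Cxx] := idxP x.
  by rewrite /q (cell_inj im xm Cx Cxx).
have q_nd : {homo q : x y / x <= y}.
  move=> x y xy; have [xm /andP[Fx _]] := idxP x.
  have [ym /andP[_ Fy]] := idxP y.
  rewrite /q; have [yx|/a_lt/(_ ym)/ltW//|->//] := ltngtP (idx y) (idx x).
  by have := real_cdf_nd mu xy; have := c_mono yx (leqW xm); lra.
have q_dist : distortion mu q r = (m.+1%:R * v)%:E.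
  pose s := iota 0 m.+1.
  have sT : [set: measurableTypeR R] = \big[setU/set0]_(i <- s) C i.
    rewrite -bigcup_seq; apply/seteqP; split => x // _; have [xm Cx] := idxP x.
    by exists (idx x) => //=; rewrite mem_iota.
  have mq : measurable_fun [set: measurableTypeR R]
      (fun x : measurableTypeR R => (`|x - q x| `^ r)%:E).
    apply/measurable_EFinP; apply: (measurableT_comp (measurable_powR r)).
    apply: measurableT_comp => //; apply: measurable_funB => //.
    exact: nondecreasing_measurable.
  rewrite /distortion [X in integral _ X]sT ge0_integral_bigsetU//;
    last 3 first.
  - exact: iota_uniq.
  - move=> i j; rewrite /= !mem_iota /= !ltnS => im jm [x [Cix Cjx]].
    exact: cell_inj Cix Cjx.
  - by rewrite -sT.
  rewrite (eq_big_seq (fun=> v%:E)); last first.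
    move=> i; rewrite mem_iota /= ltnS => im.
    rewrite -(c_cost im) (best_cost_minimizer (amin i)).
    rewrite -(EFin_cost hr hmom (a i) (mC i)).
    by apply: eq_integral => x /set_mem; rewrite -cellE// => ->.
  rewrite sumEFin; congr EFin.
  by rewrite big_const_seq count_predT size_iota iter_addr_0 mulr_natl.
exists q; split; [split|split].
- exact: nondecreasing_measurable.
- by rewrite q_range; apply: finite_set_countable; exact: finite_image.
- by rewrite q_range; apply: inj_card_eq => i j; rewrite !inE; exact: a_inj.
- rewrite q_range => _ [i im <-]; rewrite cellE//.
  move=> x y /andP[cx _] /andP[_ yc] z.
  move=> /andP[/(real_cdf_nd mu) xz /(real_cdf_nd mu) zy].
  by apply/andP; split; lra.
- rewrite q_range => _ [i im <-]; rewrite cellE//.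
  apply/optimal_cond_probP => //; exact: cell_gt0.
- rewrite q_range => _ [i im <-]; rewrite cellE// EFin_cost// q_dist.
  by rewrite -(best_cost_minimizer (amin i)) c_cost// -EFinM mulKf// pnatr_eq0.
have /choice[s sP] k :
    exists s, (0 < k <= m)%N -> forall t, c k <= F t <-> s <= t.
  have [/cut[s sP]|_] := boolP (0 < k <= m)%N; first by exists s.
  by exists 0.
pose b i : \bar R :=
  if i == 0%N then -oo%E else if (m < i)%N then +oo%E else (s i)%:E.
have bE i : (i <= m)%N -> C i = [set x : R | (b i <= x%:E < b i.+1)%E].
  move=> im; apply/seteqP; split => x.
    move=> /andP[cF Fc]; apply/andP; split.
      rewrite /b; case: eqP => [_|/eqP i0]; first exact: leNye.
      by rewrite ltnNge im /= lee_fin -sP// lt0n i0.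
    rewrite /b /= ltnS; case: leqP => im'; first exact: ltry.
    by rewrite lte_fin ltNge; apply/negP; rewrite -sP//= leNgt Fc.
  move=> /andP[bx xb]; apply/andP; split.
    move: bx; rewrite /b; case: eqP => [->|/eqP i0].
      by rewrite c_first real_cdf_ge0.
    by rewrite ltnNge im /= lee_fin -sP// lt0n i0.
  move: xb; rewrite /b /= ltnS; case: leqP => im'.
    have -> : i = m by apply/eqP; rewrite eqn_leq im.
    by rewrite c_last => _; have := real_cdf_le1 mu x; lra.
  by rewrite lte_fin ltNge => /negP; rewrite -sP//= => /negP; rewrite -ltNge.
exists b; split => //.
- by rewrite /b /= ltnSn.
- move=> i; rewrite ltnS => im; have [x] := cell_neq0 im.
  by rewrite bE// => /andP[]; exact: le_lt_trans.
rewrite q_range; apply/seteqP; split.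
  by move=> _ [_ [i /= im <-] <-]; exists i => //; rewrite cellE// bE.
move=> _ [i /= im <-]; exists (a i); first by exists i.
by rewrite cellE// bE.
Qed.

End EqualSplitQuantizer.

Lemma gersho_quantizer_exists (R : realType) (r : R)
    (mu : probability (measurableTypeR R) R) (n : nat) :
  (forall x : R, mu [set x] = 0%E) -> 1 < r ->
  (\int[mu]_x (`|x| `^ r)%:E < +oo)%E -> (0 < n)%N ->
  gersho_quantizers n mu r !=set0.
Proof.
move=> hpt hr hmom; case: n => // m _.
have [W [_ _ _ Wc]] := equal_split (cell_cost_mono hr hmom)
  (cell_cost_diag r mu) (cell_cost_modulus hpt hr hmom) m.
have [|c [c0 cm cnd cV]] := Wc 2; first by [].
exact: (equal_split_quantizer hpt hr hmom c0 cm cnd cV).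
Qed.

(** * Uniqueness *)

Section SupportGap.
Context {R : realType} (mu : probability (measurableTypeR R) R).
Context (hpt : forall x : R, mu [set x] = 0%E).
Local Notation F := (real_cdf mu).

(** Take the leftmost point s where F reaches u: mass lies in every interval
    (s - h, s]. *)
Lemma support_point_cdf u : 0 < u -> u < 1 ->
  exists s, [/\ F s = u, measure_support mu s & forall t, u <= F t -> s <= t].
Proof.
move=> u0 u1; have [x Fx] := real_cdf_lt_exists mu u0.
have [y Fy] := real_cdf_ge_exists mu u1.
have [s Fs sE] := cdf_upset hpt Fx Fy.
have sP t : u <= F t -> s <= t.
  move=> ut; have : [set t | u <= F t] t by [].
  by rewrite sE /= in_itv/= andbT.
exists s; split => // U oU Us.
have /nbhs_ballP[h /= h0 hU] : nbhs s U by exact: open_nbhs_nbhs.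
have Fsh : F (s - h / 2) < u.
  by rewrite ltNge; apply/negP => /sP; lra.
have sub : `]s - h / 2, s]%classic `<=` U.
  move=> t /=; rewrite in_itv/= => st; apply: hU.
  by rewrite /ball /= ger0_norm; lra.
apply: (@lt_le_trans _ _ (mu `]s - h / 2, s]%classic)); last first.
  by rewrite le_measure ?inE//; exact: open_measurable.
rewrite -fin_probE; last exact: measurable_itv.
by rewrite lte_fin fin_prob_itv_oc; lra.
Qed.

(** There are support points s <= c and t > d, namely the leftmost points
    where F takes the values F c and (F d + 1)/2. The support being an
    interval, it contains the midpoint of c and d. *)
Lemma interval_support_gt0 c d : is_interval (measure_support mu) -> c < d ->
  (0 < mu `]-oo, c]%classic)%E -> (0 < mu `[d, +oo[%classic)%E ->
  (0 < mu `[c, d[%classic)%E.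
Proof.
move=> supp cd c0 d0.
have Fc0 : 0 < F c by rewrite -lte_fin fin_probE.
have Fd1 : F d < 1.
  have m2 : measurable (`[d, +oo[%classic : mset R).
    exact: measurable_itv.
  by move: d0; rewrite -fin_probE// lte_fin fin_prob_itv_cy//; lra.
have Fcd := real_cdf_nd mu (ltW cd).
have [|s [Fs ss sP]] := support_point_cdf Fc0; first by lra.
have [||t [Ft st _]] := @support_point_cdf ((F d + 1) / 2); [by lra|by lra|].
have sc : s <= c by exact: sP.
have dt : d < t.
  by rewrite ltNge; apply/negP => /(real_cdf_nd mu); lra.
have mid : measure_support mu ((c + d) / 2).
  by apply: (supp s t) => //; apply/andP; split; lra.
have cdo : open (`]c, d[%classic : set R) by exact: interval_open.
apply: lt_le_trans (mid _ cdo _) _; first by rewrite /= in_itv/=; lra.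
by rewrite le_measure ?inE//; exact: subset_itvW.
Qed.

End SupportGap.

Definition ereal_cell {R : realType} (b : nat -> \bar R) (i : nat) : set R :=
  [set x : R | (b i <= x%:E < b i.+1)%E].

Section Uniqueness.
Context {R : realType} (r : R) (mu : probability (measurableTypeR R) R).
Context (hpt : forall x : R, mu [set x] = 0%E).
Context (hr : 1 < r) (hmom : (\int[mu]_x (`|x| `^ r)%:E < +oo)%E).
Context (n : nat) (hn : (0 < n)%N).

(** Indexing the cells of a quantizer by their rank, with the level and the cost
    of each, makes two quantizers comparable cut by cut. *)
Record gersho_cells (q : R -> R) (b : nat -> \bar R) (a : nat -> R) (v : R) :
    Prop := GershoCells {
  cells_first : b 0%N = -oo%E;
  cells_last : b n = +oo%E;
  cells_lt : forall i, (i < n)%N -> (b i < b i.+1)%E;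
  cells_cover : forall x, exists2 i, (i < n)%N & ereal_cell b i x;
  cells_meas : forall i, (i < n)%N ->
    measurable (ereal_cell b i : mset R);
  cells_gt0 : forall i, (i < n)%N -> (0 < mu (ereal_cell b i))%E;
  cells_val : forall i, (i < n)%N -> forall x, ereal_cell b i x -> q x = a i;
  cells_min : forall i, (i < n)%N ->
    forall c, cost r mu (ereal_cell b i) (a i) <= cost r mu (ereal_cell b i) c;
  cells_cost : forall i, (i < n)%N -> cost r mu (ereal_cell b i) (a i) = v }.

(** The common cost is positive because some cell has positive measure; hence
    no cell is negligible, and optimality for the conditional probability is
    minimality of the cost. *)
Lemma gersho_quantizer_cells q : gersho_quantizers n mu r q ->
  exists b a v, gersho_cells q b a v.
Proof.
case=> -[mq _] [_ _ q_opt q_equi [b [b0 bn blt bE]]].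
pose v := fine ((n%:R^-1)%:E * distortion mu q r).
have /choice[a aP] i :
    exists a, (i < n)%N -> range q a /\ codecell q a = ereal_cell b i.
  have [i_n|_] := boolP (i < n)%N; last by exists 0.
  have : [set [set x : R | (b i <= x%:E < b i.+1)%E] | i in `I_n]
      (ereal_cell b i) by exists i.
  by rewrite -bE => -[a qa aE]; exists a.
have mcell i : (i < n)%N -> measurable (ereal_cell b i : mset R).
  move=> /aP[_ <-]; rewrite /codecell -[X in measurable X]setTI.
  by apply: mq => //; exact: measurable_set1.
have cover x : exists2 i, (i < n)%N & ereal_cell b i x.
  have : (codecell q @` range q) (codecell q (q x)).
    by exists (q x) => //; exists x.
  rewrite bE => -[i /= i_n cE]; exists i => //.
  by rewrite /ereal_cell cE.
have cell_cost i : (i < n)%N -> cost r mu (ereal_cell b i) (a i) = v.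
  move=> i_n; have [qa aE] := aP _ i_n.
  by rewrite /v -(q_equi _ qa) aE EFin_cost//; exact: mcell.
have [i0 i0n mi0] := gt0_prob_cover mu mcell cover.
have v0 : 0 < v by rewrite -(cell_cost i0)// cost_gt0//; exact: mcell.
have cell_gt0 i : (i < n)%N -> (0 < mu (ereal_cell b i))%E.
  move=> i_n; rewrite lt0e measure_ge0 andbT; apply/eqP => C0.
  by have := cell_cost i i_n; rewrite cost_null//; [lra|exact: mcell].
exists b, a, v; split => //.
- by move=> i i_n x; have [_ <-] := aP _ i_n.
- move=> i i_n; have [qa aE] := aP _ i_n.
  have := q_opt _ qa; rewrite aE optimal_cond_probP//; first exact: mcell.
  exact: cell_gt0.
Qed.

(** At the first index i + 1 where b' < b, the cell of b' is included in that
    of b and misses [b' (i+1), b (i+1)). This gap has positive measure because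
    there is mass on both sides of it, on the left in the cell of b' of rank i
    and on the right in the cell of b of rank i + 1. *)
Lemma gersho_cells_le q b a v q' b' a' v' : is_interval (measure_support mu) ->
  gersho_cells q b a v -> gersho_cells q' b' a' v' -> v <= v' ->
  forall i, (i <= n)%N -> (b i <= b' i)%E.
Proof.
move=> supp D D' vv'; elim=> [|i IH i_n].
  by rewrite (cells_first D) leNye.
have bi := IH (ltnW i_n).
rewrite leNgt; apply/negP => b'b.
have i1n : (i.+1 < n)%N.
  rewrite ltn_neqAle i_n andbT; apply: contraTneq b'b => ->.
  by rewrite (cells_last D') -leNgt leey.
have [c cE] : exists c, b' i.+1 = c%:E.
  have := cells_lt D' i_n; move: b'b; case: (b' i.+1) => [c _ _|//|_].
  - by exists c.
  - by rewrite ltNge leey.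
  - by rewrite ltNge leNye.
have [d dE] : exists d, b i.+1 = d%:E.
  have := cells_lt D i1n; move: b'b; case: (b i.+1) => [d _ _|_|].
  - by exists d.
  - by rewrite ltNge leey.
  - by rewrite ltNge leNye.
have cd : c < d by rewrite -lte_fin -cE -dE.
have sub : ereal_cell b' i `<=` ereal_cell b i.
  move=> x /andP[bx xb]; apply/andP; split; first exact: le_trans bx.
  exact: lt_trans b'b.
have mC := cells_meas D i_n; have mC' := cells_meas D' i_n.
have gap : (0 < mu `[c, d[%classic)%E.
  apply: interval_support_gt0 => //.
    apply: lt_le_trans (cells_gt0 D' i_n) _; rewrite le_measure ?inE//.
    by move=> x /andP[_]; rewrite cE lte_fin /= in_itv/= => /ltW.
  apply: lt_le_trans (cells_gt0 D i1n) _; rewrite le_measure ?inE//.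
    exact: (cells_meas D).
  by move=> x /andP[]; rewrite dE lee_fin /= in_itv/= andbT.
have mD : measurable (ereal_cell b i `\` ereal_cell b' i : mset R).
  exact: measurableD.
have D0 : (0 < mu (ereal_cell b i `\` ereal_cell b' i))%E.
  apply: lt_le_trans gap _; rewrite le_measure ?inE//.
  move=> x; rewrite /= in_itv/= => /andP[cx xd]; split.
    apply/andP; split; last by rewrite dE lte_fin.
    by rewrite (le_trans bi)// (le_trans (ltW (cells_lt D' i_n)))// cE lee_fin.
  by move=> /andP[_]; rewrite cE lte_fin; lra.
have := cells_min D' i_n (a i); rewrite (cells_cost D' i_n).
have := cells_cost D i_n; rewrite (cost_setD hr hmom (a i) mC' mC sub).
by have := cost_gt0 hpt hr hmom (a i) mD D0; lra.
Qed.

(** The last cells both end at +oo, and that of b' starts later. *)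
Lemma gersho_cells_cost_le q b a v q' b' a' v' :
  is_interval (measure_support mu) ->
  gersho_cells q b a v -> gersho_cells q' b' a' v' -> v <= v' -> v' <= v.
Proof.
move=> supp D D' vv'.
have [k nk] : exists k, n = k.+1 by exists n.-1; rewrite prednK.
have kn : (k < n)%N by rewrite nk.
have bk := gersho_cells_le supp D D' vv' (ltnW kn).
have sub : ereal_cell b' k `<=` ereal_cell b k.
  move=> x /andP[bx _]; apply/andP; split; first exact: le_trans bx.
  by rewrite -nk (cells_last D) ltry.
rewrite -(cells_cost D' kn) -(cells_cost D kn).
rewrite (le_trans (cells_min D' kn (a k)))//.
by apply: cost_subset => //; [exact: (cells_meas D')|exact: (cells_meas D)].
Qed.

Lemma gersho_quantizer_unique q q' : is_interval (measure_support mu) ->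
  gersho_quantizers n mu r q -> gersho_quantizers n mu r q' -> q = q'.
Proof.
move=> supp /gersho_quantizer_cells[b [a [v D]]].
move=> /gersho_quantizer_cells[b' [a' [v' D']]].
have vE : v = v'.
  have [vv'|/ltW v'v] := leP v v'; apply/le_anti.
    by rewrite vv' (gersho_cells_cost_le supp D D').
  by rewrite v'v (gersho_cells_cost_le supp D' D).
have bE i : (i <= n)%N -> b i = b' i.
  move=> i_n; apply/le_anti.
  by rewrite (gersho_cells_le supp D D') ?vE// (gersho_cells_le supp D' D) ?vE.
apply/funext => x; have [i i_n bx] := cells_cover D x.
have cE : ereal_cell b i = ereal_cell b' i.
  by rewrite /ereal_cell !bE// ltnW.
rewrite (cells_val D i_n bx); move: bx; rewrite cE => /(cells_val D' i_n) ->.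
have mina' c :
    cost r mu (ereal_cell b i) (a' i) <= cost r mu (ereal_cell b i) c.
  by rewrite cE; exact: (cells_min D' i_n).
exact: (cost_minimizer_unique hr hmom (cells_meas D i_n) (cells_gt0 D i_n)
  (cells_min D i_n) mina').
Qed.

End Uniqueness.

(** A singleton has no proper nonempty subset, so it is an atom as soon as it
    has positive measure. *)
Lemma non_atomic_set1 (R : realType) (mu : probability (measurableTypeR R) R) :
  non_atomic mu -> forall x : R, mu [set x] = 0%E.
Proof.
move=> na x; apply/eqP; rewrite -measure_le0 leNgt; apply/negP => x0.
apply: (na [set x]); split => //.
move=> B _ Bx; have [xB|xB] := pselect (B x).
  by right; congr (mu _); apply/seteqP; split => // _ ->.
left; rewrite (_ : B = set0) ?measure0//.
by apply/seteqP; split => // y By; apply: xB; rewrite -(Bx _ By).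
Qed.

Local Open Scope ereal_scope.

Theorem proposition2p5 (R : realType) (r : R)
    (mu : probability (measurableTypeR R) R)
    (hr : (1 < r)%R)
    (hmu : non_atomic mu)
    (hmom : \int[mu]_x (`|x| `^ r)%:E < +oo)
    (n : nat) (hn : (0 < n)%N) :
  gersho_quantizers n mu r !=set0 /\
  (is_interval (measure_support mu) ->
   (gersho_quantizers n mu r #= `I_1)%card).
Proof.
have hpt := non_atomic_set1 hmu.
have [q qG] := gersho_quantizer_exists hpt hr hmom hn.
split=> [|supp]; first by exists q.
rewrite (_ : gersho_quantizers n mu r = [set q]); first exact: card_set1.
apply/seteqP; split => [q' q'G|_ -> //].
exact: (gersho_quantizer_unique hpt hr hmom hn supp q'G qG).
Qed.
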